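(* For a connected finite simplicial graph $\Gamma$, the action of the right-angled Artin group $A(\Gamma)$ on the extension graph $\Gamma^e$ satisfies the finiteness property; that is, every loxodromic element of $A(\Gamma)$ has an axial subgraph in $\Gamma^e$.
   Context: For a finite connected simplicial graph $\Gamma$, $A(\Gamma)=\langle v\in V(\Gamma)\mid [u,v]=1 \text{ for all } \{u,v\}\in E(\Gamma)\rangle$ is its right-angled Artin group. For $x,h\in A(\Gamma)$ write $x^h=h^{-1}xh$. The extension graph $\Gamma^e$ is the simplicial graph with vertex set $\{v^g\mid v\in V(\Gamma), g\in A(\Gamma)\}\subset A(\Gamma)$, where two distinct vertices are joined by an edge exactly when they commute in $A(\Gamma)$. It carries the edge metric $d_{\Gamma^e}$ and is $\delta$-hyperbolic. $A(\Gamma)$ acts on $\Gamma^e$ on the right by conjugation, $x\mapsto x^g$. An element $g$ is loxodromic if $\tau(g)=\lim_{n\to\infty} d_{\Gamma^e}(x,x^{g^n})/n>0$ (independent of the vertex $x$). A subgraph $\mathcal{H}\subseteq\Gamma^e$ is weakly convex if the inclusion $(\mathcal{H},d_{\mathcal{H}})\hookrightarrow(\Gamma^e,d_{\Gamma^e})$ is an isometric embedding, where $d_{\mathcal{H}}$ is the edge metric of $\mathcal{H}$. For a loxodromic $g$, an axial subgraph of $g$ is a nonempty weakly convex, locally finite subgraph that is preserved by $g$ and on which the induced action of $\langle g\rangle$ is cocompact. *)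

(* Defs.v *)
From HB Require Import structures.
From mathcomp Require Import all_boot all_order all_algebra.
From mathcomp Require Import generic_quotient.
From mathcomp Require Import all_classical all_reals all_analysis.

Set Implicit Arguments.
Unset Strict Implicit.
Unset Printing Implicit Defensive.

Import Order.TTheory GRing.Theory Num.Theory.
Import numFieldNormedType.Exports.

Local Open Scope classical_set_scope.
Local Open Scope quotient_scope.
Local Open Scope group_scope.

(** * Right-angled Artin groups *)

(* A word in the letters v^{+1} = (v, true) and v^{-1} = (v, false). *)
Definition raag_word (V : Type) := seq (V * bool).

(* The congruence on words presenting < V | [u, v] = 1 for all edges {u, v} >. *)
Inductive raag_cong (V : Type) (e : rel V) : raag_word V -> raag_word V -> Prop :=
| raag_refl w : raag_cong e w w
| raag_sym w1 w2 : raag_cong e w1 w2 -> raag_cong e w2 w1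
| raag_trans w1 w2 w3 :
    raag_cong e w1 w2 -> raag_cong e w2 w3 -> raag_cong e w1 w3
| raag_cat w1 w1' w2 w2' :
    raag_cong e w1 w1' -> raag_cong e w2 w2' ->
    raag_cong e (w1 ++ w2) (w1' ++ w2')
| raag_cancel v b : raag_cong e [:: (v, b); (v, ~~ b)] [::]
| raag_comm u v :
    e u v -> raag_cong e [:: (u, true); (v, true)] [:: (v, true); (u, true)].

Definition raag_word_inv (V : Type) (w : raag_word V) : raag_word V :=
  rev [seq (l.1, ~~ l.2) | l <- w].

Section Raag.
Variables (V : choiceType) (e : rel V).
Implicit Types w : raag_word V.

Definition raag_congb : rel (raag_word V) := fun w1 w2 => `[< raag_cong e w1 w2 >].

Lemma raag_congb_refl : reflexive raag_congb.
Proof. by move=> w; apply/asboolP; exact: raag_refl. Qed.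

Lemma raag_congb_sym : symmetric raag_congb.
Proof. by move=> w1 w2; apply/asboolP/asboolP; exact: raag_sym. Qed.

Lemma raag_congb_trans : transitive raag_congb.
Proof.
move=> w2 w1 w3 /asboolP h1 /asboolP h2.
by apply/asboolP; exact: raag_trans h1 h2.
Qed.

Canonical raag_equiv :=
  EquivRel raag_congb raag_congb_refl raag_congb_sym raag_congb_trans.

Definition raag := {eq_quot raag_equiv}.
HB.instance Definition _ := Choice.on raag.
HB.instance Definition _ := Quotient.on raag.
HB.instance Definition _ := EqQuotient.on raag.

Definition raag_pi w : raag := \pi_raag w.

Lemma raag_piP w1 w2 : raag_pi w1 = raag_pi w2 <-> raag_cong e w1 w2.
Proof.
split=> [/eqmodP/asboolP//|h].
by apply/eqmodP/asboolP.
Qed.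

Lemma raag_reprP w : raag_cong e (repr (raag_pi w)) w.
Proof. by apply/raag_piP; rewrite /raag_pi reprK. Qed.

Lemma raag_word_inv_cat w1 w2 :
  raag_word_inv (w1 ++ w2) = raag_word_inv w2 ++ raag_word_inv w1.
Proof. by rewrite /raag_word_inv map_cat rev_cat. Qed.

Lemma raag_word_invK : involutive (@raag_word_inv V).
Proof.
move=> w; rewrite /raag_word_inv -map_rev revK -map_comp.
by rewrite -[RHS]map_id; apply: eq_map => -[v b] /=; rewrite negbK.
Qed.

Lemma raag_cong_mulVw w : raag_cong e (raag_word_inv w ++ w) [::].
Proof.
elim: w => [|[v b] w IH]; first exact: raag_refl.
rewrite -cat1s raag_word_inv_cat -catA.
apply: raag_trans (IH); apply: raag_cat; first exact: raag_refl.
rewrite catA -[X in raag_cong e _ X]cat0s.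
apply: raag_cat; last exact: raag_refl.
by rewrite /raag_word_inv /= /rev /= -{2}[b]negbK; exact: raag_cancel.
Qed.

Lemma raag_cong_mulwV w : raag_cong e (w ++ raag_word_inv w) [::].
Proof. by rewrite -{1}[w]raag_word_invK; exact: raag_cong_mulVw. Qed.

Lemma raag_cong_inv w1 w2 :
  raag_cong e w1 w2 -> raag_cong e (raag_word_inv w1) (raag_word_inv w2).
Proof.
move=> h; have r w := raag_refl e w.
rewrite -[raag_word_inv w1]cats0.
apply: raag_trans (raag_cat (r _) (raag_sym (raag_cong_mulwV w2))) _.
rewrite catA -[X in raag_cong e _ X]cat0s; apply: raag_cat (r _).
by apply: raag_trans (raag_cong_mulVw w1); apply: raag_cat (r _) (raag_sym h).
Qed.

Definition raag_one : raag := raag_pi [::].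
Definition raag_mul (x y : raag) : raag := raag_pi (repr x ++ repr y).
Definition raag_inv (x : raag) : raag := raag_pi (raag_word_inv (repr x)).

Lemma raag_piK (x : raag) : raag_pi (repr x) = x.
Proof. by rewrite /raag_pi reprK. Qed.

Lemma raag_mul_pi w1 w2 : raag_mul (raag_pi w1) (raag_pi w2) = raag_pi (w1 ++ w2).
Proof. by apply/raag_piP; apply: raag_cat; exact: raag_reprP. Qed.

Lemma raag_inv_pi w : raag_inv (raag_pi w) = raag_pi (raag_word_inv w).
Proof. by apply/raag_piP; apply: raag_cong_inv; exact: raag_reprP. Qed.

Lemma raag_mulA : associative raag_mul.
Proof.
move=> x y z; rewrite -[x]raag_piK -[y]raag_piK -[z]raag_piK.
by rewrite !raag_mul_pi catA.
Qed.

Lemma raag_mul1 : left_id raag_one raag_mul.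
Proof. by move=> x; rewrite -[x]raag_piK raag_mul_pi. Qed.

Lemma raag_mulr1 : right_id raag_one raag_mul.
Proof. by move=> x; rewrite -[x]raag_piK raag_mul_pi cats0. Qed.

Lemma raag_mulV : left_inverse raag_one raag_inv raag_mul.
Proof.
move=> x; rewrite -[x]raag_piK raag_inv_pi raag_mul_pi.
by apply/raag_piP; exact: raag_cong_mulVw.
Qed.

Lemma raag_mulrV : right_inverse raag_one raag_inv raag_mul.
Proof.
move=> x; rewrite -[x]raag_piK raag_inv_pi raag_mul_pi.
by apply/raag_piP; exact: raag_cong_mulwV.
Qed.

HB.instance Definition _ := isGroup.Build raag
  raag_mulA raag_mul1 raag_mulr1 raag_mulV raag_mulrV.

Definition raag_gen (v : V) : raag := raag_pi [:: (v, true)].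

End Raag.

(** * Simplicial graphs and their edge metric *)

Record sgraph (T : Type) := SGraph {
  vset : set T;
  adj : rel T;
  adj_sym : symmetric adj;
  adj_irr : irreflexive adj;
  adj_vset : forall x y, adj x y -> vset x
}.

Definition subgraph (T : Type) (H G : sgraph T) :=
  vset H `<=` vset G /\ (forall x y, adj H x y -> adj G x y).

Definition walk (T : Type) (G : sgraph T) (x y : T) (n : nat) :=
  vset G x /\ exists2 p : seq T, path (adj G) x p & last x p = y /\ size p = n.

(* Equal to +oo when x and y are not joined by a walk in G. *)
Definition edge_dist (R : realType) (T : Type) (G : sgraph T) (x y : T) : \bar R :=
  ereal_inf [set (n%:R)%:E | n in walk G x y].

Definition weakly_convex (R : realType) (T : Type) (H G : sgraph T) :=
  subgraph H G /\
  forall x y, vset H x -> vset H y -> edge_dist R H x y = edge_dist R G x y.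

Definition locally_finite (T : Type) (H : sgraph T) :=
  forall x, vset H x -> finite_set [set y | adj H x y].

(** * The extension graph and the conjugation action *)

Section ExtensionGraph.
Variables (V : choiceType) (e : rel V).
Implicit Types (x y g : raag e) (H K : sgraph (raag e)).

Definition ext_vset : set (raag e) :=
  [set x | exists v g, x = raag_gen e v ^ g].

Definition ext_adj : rel (raag e) := fun x y =>
  [&& x \in ext_vset, y \in ext_vset, x != y & x * y == y * x].

Lemma ext_adj_sym : symmetric ext_adj.
Proof.
by move=> x y; rewrite /ext_adj andbCA [x == y]eq_sym [x * y == _]eq_sym.
Qed.

Lemma ext_adj_irr : irreflexive ext_adj.
Proof. by move=> x; rewrite /ext_adj eqxx !andbF. Qed.

Lemma ext_adj_vset x y : ext_adj x y -> ext_vset x.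
Proof. by move=> /andP[/set_mem]. Qed.

Definition ext_graph : sgraph (raag e) :=
  SGraph ext_adj_sym ext_adj_irr ext_adj_vset.

Definition translation_length (R : realType) x g : R :=
  lim ((fun n : nat =>
    (fine (edge_dist R ext_graph x (x ^ (g ^+ n))%g) / n%:R)%R) @ \oo).

(* The choice of x is immaterial: the translation length is independent of it. *)
Definition loxodromic (R : realType) g :=
  exists2 x, vset ext_graph x & (0 < translation_length R x g)%R.

Definition preserved_by g H :=
  (fun x => x ^ g) @` vset H = vset H /\
  (forall x y, adj H (x ^ g) (y ^ g) = adj H x y).

(* The cyclic subgroup generated by g. *)
Definition cyclic_set g : set (raag e) :=
  [set h | exists n : nat, h = g ^+ n \/ h = g ^- n].

(* Cocompactness: the <g>-translates of some compact part of H cover H. Compact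
   subsets of the realization of a graph lie in finite subgraphs K. *)
Definition cocompact_on g H :=
  exists K, [/\ subgraph K H, finite_set (vset K),
    (forall x, vset H x ->
       exists k h, [/\ vset K k, cyclic_set g h & x = k ^ h]) &
    (forall x y, adj H x y ->
       exists k l h, [/\ adj K k l, cyclic_set g h, x = k ^ h & y = l ^ h])].

Definition axial_subgraph (R : realType) g H :=
  [/\ vset H !=set0, weakly_convex R H ext_graph, locally_finite H,
      preserved_by g H & cocompact_on g H].

Definition finiteness_property (R : realType) :=
  forall g, loxodromic R g -> exists H, axial_subgraph R g H.

End ExtensionGraph.

(* Main.v *)
Require Import Defs.
From mathcomp Require Import all_boot all_order all_algebra.
From mathcomp Require Import all_classical all_reals all_analysis.
From mathcomp Require Import zify.

(* Write x^h for h^-1 x h. For a reduced word c_0 ... c_{m-1}, let Y be the set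
   of group elements spelled by its final segments up to commutation, i.e. by
   the subsets I of positions ("ideals") that contain every later position
   whose letter does not commute with the letter of a position of I. A
   generator v acts on ideals by permuting cyclically, along each maximal run of
   v-edges of Y, the points of that run (canonical completion in the sense of
   Haglund and Wise). This is an action of the whole group, so its orbit map
   A -> Y, h |-> p(h), is well defined; it is the identity on Y, and p(a h) and
   p(h) differ by a power of the generator a on the left. Hence
   v^h |-> v^p(h) retracts the extension graph onto the union of the copies
   Gamma^h, h in Y, which is therefore isometrically embedded. The same action
   shows that nonempty reduced words are nontrivial, from which follow the
   centralizer of a generator and the fact that commuting conjugates of
   generators are simultaneously conjugate to generators.

   For g loxodromic, take a shortest word w representing a conjugate of g. All
   powers of w are reduced, and the sets Y attached to them exhaust a
   <g>-invariant set whose copies of Gamma span the axial subgraph. The support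
   of w is not a join, since otherwise g would have a bounded orbit; so
   noncommutation propagates along the word, an ideal is determined up to
   <g> by a bounded piece, and the quotient by <g> is finite. Local finiteness
   holds because no nontrivial power of g fixes a vertex. *)

Set Implicit Arguments.
Unset Strict Implicit.
Unset Printing Implicit Defensive.

Import Order.TTheory GRing.Theory Num.Theory.
Import numFieldNormedType.Exports.

Local Open Scope classical_set_scope.
Local Open Scope group_scope.

(** * Words up to commutation of letters *)

Definition inv_letter (V : Type) (l : V * bool) := (l.1, ~~ l.2).

Lemma inv_letterK (V : Type) : involutive (@inv_letter V).
Proof. by case=> v b; rewrite /inv_letter /= negbK. Qed.

Section Words.
Variables (V : choiceType) (e : rel V).
Hypothesis e_sym : symmetric e.
Implicit Types (w : raag_word V) (l : V * bool) (u v : V).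

Notation pi := (raag_pi e).
Notation gen := (raag_gen e).

(* Letters passing each other: unlike in most texts, a letter may also move
   past equal letters, so [starts], [ends] and [reduced] below are up to
   commutation of all letters that commute in the group. *)
Definition star u v := (u == v) || e u v.

Lemma star_sym : symmetric star.
Proof. by move=> u v; rewrite /star eq_sym e_sym. Qed.

Lemma star_refl : reflexive star.
Proof. by move=> u; rewrite /star eqxx. Qed.

Lemma raag_pi_cat w1 w2 : pi (w1 ++ w2) = pi w1 * pi w2.
Proof. by rewrite -raag_mul_pi. Qed.

Lemma raag_pi_cons l w : pi (l :: w) = pi [:: l] * pi w.
Proof. by rewrite -raag_pi_cat. Qed.

Lemma raag_pi_nil : pi [::] = 1. Proof. by []. Qed.

Lemma raag_pi_inv w : pi (raag_word_inv w) = (pi w)^-1.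
Proof. by rewrite -raag_inv_pi. Qed.

Lemma raag_pi_inv_letter l : pi [:: inv_letter l] = (pi [:: l])^-1.
Proof. by rewrite -raag_pi_inv. Qed.

Lemma raag_pi_letter v b : pi [:: (v, b)] = if b then gen v else (gen v)^-1.
Proof. by case: b => //; rewrite -raag_pi_inv_letter. Qed.

Lemma raag_pi_cons_gen v b w :
  pi ((v, b) :: w) = (if b then gen v else (gen v)^-1) * pi w.
Proof. by rewrite raag_pi_cons raag_pi_letter. Qed.

Lemma commute_gen u v : star u v -> commute (gen u) (gen v).
Proof.
case/orP=> [/eqP ->|euv]; first exact: commute_refl.
rewrite /commute -!raag_pi_cat; apply/raag_piP; exact: raag_comm.
Qed.

Lemma commute_gen_letter u l : star u l.1 -> commute (gen u) (pi [:: l]).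
Proof.
case: l => v b /= h; rewrite raag_pi_letter.
by case: b; last apply: commuteV; apply: commute_gen.
Qed.

Lemma commute_letters l l' : star l.1 l'.1 -> commute (pi [:: l]) (pi [:: l']).
Proof.
case: l => u b /= h; rewrite raag_pi_letter; have := commute_gen_letter h.
by case: b {h} => // /commute_sym/commuteV/commute_sym.
Qed.

Lemma commute_word (x : raag e) w :
  {in w, forall l, commute x (pi [:: l])} -> commute x (pi w).
Proof.
elim: w => [|l w IH] h; first exact: commute1.
rewrite raag_pi_cons; apply: commuteM; first by apply: h; rewrite mem_head.
by apply: IH => l' l'w; apply: h; rewrite inE l'w orbT.
Qed.

Lemma commute_gen_word u w :
  all (fun l => star u l.1) w -> commute (gen u) (pi w).
Proof.
by move=> /allP h; apply: commute_word => l /h; exact: commute_gen_letter.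
Qed.

Lemma commute_letter_word l w :
  all (fun l' => star l.1 l'.1) w -> commute (pi [:: l]) (pi w).
Proof.
by move=> /allP h; apply: commute_word => l' /h; exact: commute_letters.
Qed.

Fixpoint starts l w : bool :=
  if w is l' :: w' then (l' == l) || star l.1 l'.1 && starts l w' else false.

Definition ends l w := starts l (rev w).

Fixpoint reduced w : bool :=
  if w is l :: w' then ~~ starts (inv_letter l) w' && reduced w' else true.

Lemma starts_cat l w1 w2 : starts l (w1 ++ w2) =
  starts l w1 || all (fun l' => star l.1 l'.1) w1 && starts l w2.
Proof. by elim: w1 => //= l' w1 ->; case: (l' == l); case: star. Qed.

Lemma ends_cat l w1 w2 : ends l (w1 ++ w2) =
  ends l w2 || all (fun l' => star l.1 l'.1) w2 && ends l w1.
Proof. by rewrite /ends rev_cat starts_cat all_rev. Qed.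

Lemma starts_split l w : starts l w -> exists w1 w2,
  w = w1 ++ l :: w2 /\ all (fun l' => star l.1 l'.1) w1.
Proof.
elim: w => //= l' w IH /orP[/eqP ->|/andP[h /IH[w1 [w2 [-> h1]]]]].
  by exists [::], w.
by exists (l' :: w1), w2; rewrite /= h.
Qed.

Lemma starts_factor l w : starts l w ->
  exists w', pi w = pi [:: l] * pi w' /\ (size w' < size w)%N.
Proof.
move=> /starts_split[w1 [w2 [-> h]]]; exists (w1 ++ w2); split.
  rewrite !raag_pi_cat raag_pi_cons !mulgA.
  by rewrite (commute_letter_word h).
by rewrite !size_cat /= addnS.
Qed.

Lemma ends_factor l w : ends l w ->
  exists w', pi w = pi w' * pi [:: l] /\ (size w' < size w)%N.
Proof.
move=> /starts_split[w1 [w2 [+ h]]] => /(congr1 rev); rewrite revK => ->.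
rewrite -cat1s !rev_cat; exists (rev w2 ++ rev w1); split.
  rewrite !raag_pi_cat -!mulgA; congr (_ * _).
  by rewrite -(commute_letter_word (l := l)) ?all_rev.
by rewrite !size_cat !size_rev /= addn1 addSn addnC.
Qed.

Lemma reduced_cat w1 w2 : reduced w1 -> reduced w2 ->
  (forall l, ends l w1 -> ~~ starts (inv_letter l) w2) -> reduced (w1 ++ w2).
Proof.
elim: w1 => //= l w1 IH /andP[h1 h2] h3 h.
rewrite starts_cat (negbTE h1) /= IH //= ?andbT.
  apply/negP => /andP[h4 h5].
  have: ends l (l :: w1) by rewrite -cat1s ends_cat h4 /ends /= eqxx orbT.
  by move/h; rewrite h5.
by move=> l' h'; apply: h; rewrite -cat1s ends_cat h'.
Qed.

Lemma reduced_ends l w :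
  reduced (rcons w l) = reduced w && ~~ ends (inv_letter l) w.
Proof.
elim: w => //= l' w IH; rewrite IH -cat1s ends_cat -cats1 starts_cat /=.
have -> : (l == inv_letter l') = (l' == inv_letter l).
  by apply/eqP/eqP => ->; rewrite inv_letterK.
have -> : ends (inv_letter l) [:: l'] = (l' == inv_letter l).
  by rewrite /ends /= andbF orbF.
rewrite !andbF ?orbF.
have [->|_] := eqVneq l' (inv_letter l).
  by rewrite !andbT inv_letterK /=; case: starts; case: all; case: reduced;
    case: ends.
by rewrite !andbF !orbF; case: starts; case: reduced; case: ends.
Qed.

Lemma reduced_rev w : reduced (rev w) = reduced w.
Proof.
by elim: w => //= l w IH; rewrite rev_cons reduced_ends IH /ends revK andbC.
Qed.

Lemma starts_map_inv l w :
  starts (inv_letter l) (map (@inv_letter V) w) = starts l w.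
Proof.
elim: w => //= l' w ->; congr (_ || _).
by apply/eqP/eqP => [/(can_inj (@inv_letterK V))|->].
Qed.

Lemma reduced_inv w : reduced (raag_word_inv w) = reduced w.
Proof.
rewrite /raag_word_inv reduced_rev; elim: w => //= l w <-.
by congr (~~ _ && _); rewrite -[in RHS]starts_map_inv.
Qed.

Lemma ends_inv l w : ends l (raag_word_inv w) = starts (inv_letter l) w.
Proof.
by rewrite /ends /raag_word_inv revK -{1}[l]inv_letterK starts_map_inv.
Qed.

Lemma starts_inv l w : starts l (raag_word_inv w) = ends (inv_letter l) w.
Proof. by rewrite -[w in RHS]raag_word_invK ends_inv inv_letterK. Qed.

Lemma not_reduced_shorten w : ~~ reduced w ->
  exists w', pi w' = pi w /\ (size w' < size w)%N.
Proof.
elim: w => //= l w IH; rewrite negb_and negbK => /orP[/starts_factor|/IH].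
  move=> [w' [h1 h2]]; exists w'; split; last by rewrite ltnW.
  by rewrite raag_pi_cons h1 raag_pi_inv_letter mulVKg.
move=> [w' [h1 h2]]; exists (l :: w'); split=> //.
by rewrite raag_pi_cons h1 -raag_pi_cons.
Qed.

(** Reducedness in terms of positions, the form in which it is assumed of the letters [c] below:
    some letter between two mutually inverse ones keeps them apart. *)
Lemma reduced_nth w l0 i j : reduced w -> (i < j < size w)%N ->
  nth l0 w j = inv_letter (nth l0 w i) ->
  exists2 k, (i < k < j)%N & ~~ star (nth l0 w i).1 (nth l0 w k).1.
Proof.
elim: w i j => [|l w IH] i [|j]; rewrite ?ltn0 ?andbF //.
move: i => [|i] /= /andP[h1 h2] hj E; last first.
  have [k hk1 hk2] := IH i j h2 hj E.
  by exists k.+1.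
move: h1; rewrite -[X in starts _ X](cat_take_drop j) (drop_nth l0) // starts_cat.
rewrite negb_or /= E eqxx /= andbT => /andP[_ /allPn[l' /(nthP l0)[k]]].
rewrite size_take (hj : (j < size w)%N) => hk <-; rewrite nth_take //= => h.
by exists k.+1.
Qed.

End Words.

(** * The action of the group on the ideals of a reduced word *)

Section Ideals.
Variables (V : choiceType) (e : rel V).
Hypotheses (e_sym : symmetric e) (e_irr : irreflexive e).
Variables (c : nat -> V * bool) (m : nat).
Implicit Types (I J : nat -> bool) (u v : V) (i j k : nat).

Notation pi := (raag_pi e).
Notation gen := (raag_gen e).
Notation star := (star e).

(** With [e] in place of [star], positions with equal labels block each other, as [e] is
    irreflexive; so an ideal meets the free positions of a generator in a final segment. *)
Definition ideal I := forall i j, (i < j < m)%N -> I i ->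
  ~~ e (c i).1 (c j).1 -> I j.

Definition ideal_elt I : raag e := pi [seq c i | i <- iota 0 m & I i].

(* The positions labelled [v] that can be reached from [I] by only adding or
   only removing letters [v]. *)
Definition free I v i := [/\ (i < m)%N, (c i).1 = v &
  forall j, (j < m)%N -> ~~ star v (c j).1 -> I j = (i < j)%N].

(* The free positions are linearly ordered and [I] contains the last t of them;
   [rot_up] replaces t by t + 1 and [rot_down] by t - 1, cyclically. *)
Definition rot_up I v i := `[< (exists2 j, free I v j & ~~ I j) /\
  forall j, free I v j -> (i < j)%N -> I j >].

Definition rot_down I v i := `[< (forall j, free I v j -> ~~ I j) \/
  exists2 j, free I v j & (j < i)%N /\ I j >].

(** Up to wrapping around, multiplying by [l] adds a free letter of the same sign or cancels one of
    the opposite sign. By [free_sign] all free positions share one sign, so the test does not depend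
    on [i]. *)
Definition act (l : V * bool) I : nat -> bool := fun i =>
  if `[< free I l.1 i >] then
    if (c i).2 == l.2 then rot_up I l.1 i else rot_down I l.1 i
  else I i.

Definition run (w : raag_word V) I := foldr act I w.

Hypothesis c_reduced : forall i j, (i < j < m)%N -> c j = inv_letter (c i) ->
  exists2 k, (i < k < j)%N & ~~ star (c i).1 (c k).1.

Lemma act_label l I i : (c i).1 != l.1 -> act l I i = I i.
Proof. by rewrite /act; case: asboolP => // -[_ -> _]; rewrite eqxx. Qed.

(** Freeness depends only on the positions blocking [v], and [act l] alters none of these. *)
Lemma free_act l I v : star v l.1 -> free (act l I) v = free I v.
Proof.
move=> s; apply/funext => i; apply/propext.
by split=> -[h1 h2 h3]; split=> // j jm h; rewrite -h3 // act_label //;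
  apply: contra h => /eqP ->.
Qed.

Lemma free_actv v b I : free (act (v, b) I) v = free I v.
Proof. by rewrite free_act ?star_refl. Qed.

(** Between free positions of opposite sign there would be a blocking position, which freeness of
    the earlier one puts into [I] and freeness of the later one puts outside. *)
Lemma free_sign I v i j : free I v i -> free I v j -> (c i).2 = (c j).2.
Proof.
wlog ij : i j / (i < j)%N => [hw|].
  have [ij|ji|-> //] := ltngtP i j; first exact: hw.
  by move=> h1 h2; apply/esym/hw.
move=> [im ci hi] [jm cj hj]; apply/eqP/negPn/negP => ne.
have [||k /andP[ik kj]] := @c_reduced i j.
- by rewrite ij.
- case: (c i) (c j) ci cj ne => [? bi] [? bj] /= -> ->.
  by rewrite /inv_letter; case: bi bj => [] [].
rewrite ci => h; have := hi _ (ltn_trans kj jm) h.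
by rewrite hj ?(ltn_trans kj jm)// ik ltnNge (ltnW kj).
Qed.

Lemma free_up I v i j : ideal I -> free I v i -> free I v j -> (i < j)%N ->
  I i -> I j.
Proof.
move=> hI [_ ci _] [jm cj _] ij Ii; apply: (hI i) => //; first by rewrite ij.
by rewrite ci cj e_irr.
Qed.

Lemma free_max (P : nat -> Prop) I v : (exists2 j, free I v j & P j) ->
  exists j, [/\ free I v j, P j & forall k, free I v k -> P k -> (k <= j)%N].
Proof.
move=> ex; pose Q j := `[< free I v j /\ P j >].
have exQ : exists j, Q j by case: ex => j h1 h2; exists j; apply/asboolP.
have bQ j : Q j -> (j <= m)%N by move=> /asboolP[[/ltnW]].
exists (ex_maxn exQ bQ); case: ex_maxnP => j /asboolP[h1 h2] h.
by split=> // k k1 k2; apply: h; apply/asboolP.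
Qed.

Lemma free_min (P : nat -> Prop) I v : (exists2 j, free I v j & P j) ->
  exists j, [/\ free I v j, P j & forall k, free I v k -> P k -> (j <= k)%N].
Proof.
move=> ex; pose Q j := `[< free I v j /\ P j >].
have exQ : exists j, Q j by case: ex => j h1 h2; exists j; apply/asboolP.
exists (ex_minn exQ); case: ex_minnP => j /asboolP[h1 h2] h.
by split=> // k k1 k2; apply: h; apply/asboolP.
Qed.

Lemma rot_downK I I' v i : ideal I -> free I v i -> free I' v = free I v ->
  (forall j, free I v j -> I' j = rot_up I v j) -> rot_down I' v i = I i.
Proof.
move=> hI fi fE hI'; rewrite /rot_down fE.
have [ex|nex] := pselect (exists2 j, free I v j & ~~ I j); last first.
  have -> : I i by apply/negPn/negP => Ii; apply: nex; exists i.
  apply/asboolP; left=> j fj; rewrite hI' //.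
  by apply/negP => /asboolP[].
(* [j] is the one free position that [rot_up] adds and [rot_down] has to remove. *)
have [j [fj nj jmax]] := free_max ex.
have up k : free I v k -> (j < k)%N -> I k.
  move=> fk jk; apply/negPn/negP => nk.
  by have := jmax _ fk nk; rewrite leqNgt jk.
have I'j : I' j by rewrite hI' //; apply/asboolP; split=> // k; exact: up.
have [Ii|nIi] := boolP (I i); last first.
  apply/negbTE/asboolPn => -[/(_ _ fj)|[k fk [ki]]]; first by rewrite I'j.
  by rewrite hI' // => /asboolP[_ /(_ _ fi ki)]; rewrite (negbTE nIi).
apply/asboolP; right; exists j => //; split=> //.
rewrite ltnNge leq_eqVlt; apply/negP => /orP[/eqP ij|ij].
  by rewrite -ij Ii in nj.
by rewrite (free_up hI fi fj ij Ii) in nj.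
Qed.

Lemma rot_upK I I' v i : ideal I -> free I v i -> free I' v = free I v ->
  (forall j, free I v j -> I' j = rot_down I v j) -> rot_up I' v i = I i.
Proof.
move=> hI fi fE hI'; rewrite /rot_up fE.
have [ex|nex] := pselect (exists2 j, free I v j & I j); last first.
  have nIj j : free I v j -> ~~ I j.
    by move=> fj; apply/negP => Ij; apply: nex; exists j.
  rewrite (negbTE (nIj _ fi)); apply/negbTE/asboolPn => -[[j fj +] _].
  by rewrite hI' // => /asboolPn; apply; left.
(* [j] is the one free position that [rot_down] removes and [rot_up] has to restore. *)
have [j [fj Ij jmin]] := free_min ex.
have nI'j : ~~ I' j.
  rewrite hI' //; apply/asboolPn => -[/(_ _ fj)|[k fk [kj Ik]]].
    by rewrite Ij.
  by have := jmin _ fk Ik; rewrite leqNgt kj.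
have [Ii|nIi] := boolP (I i).
  apply/asboolP; split; first by exists j.
  by move=> k fk ik; rewrite hI' //; apply/asboolP; right; exists i.
apply/negbTE/asboolPn => -[_ /(_ _ fj) h]; move: nI'j; rewrite h //.
rewrite ltnNge leq_eqVlt; apply/negP => /orP[/eqP ij|ij].
  by rewrite -ij Ij in nIi.
by rewrite (free_up hI fj fi ij Ij) in nIi.
Qed.

Lemma actK v b I : ideal I -> act (v, ~~ b) (act (v, b) I) = I.
Proof.
move=> hI; apply/funext => i; rewrite {1}/act /= free_actv.
case: asboolP => fi; last by rewrite /act /=; case: asboolP.
have sgn j : free I v j -> act (v, b) I j =
    if (c i).2 == b then rot_up I v j else rot_down I v j.
  by move=> fj; rewrite /act /= (asboolT fj) (free_sign fi fj).
have [s|s] := eqVneq (c i).2 b.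
  have -> : ((c i).2 == ~~ b) = false by rewrite s; case: (b).
  apply: (rot_downK hI fi); first exact: free_actv.
  by move=> j /sgn ->; rewrite s eqxx.
have -> : ((c i).2 == ~~ b) by move: s; case: (c i).2 b {sgn} => [] [].
apply: (rot_upK hI fi); first exact: free_actv.
by move=> j /sgn ->; rewrite (negbTE s).
Qed.

Lemma rot_up_up I v i j : ideal I -> free I v i -> free I v j -> (i < j)%N ->
  rot_up I v i -> rot_up I v j.
Proof.
move=> hI fi fj ij /asboolP[h1 h2]; apply/asboolP; split=> // k fk jk.
by apply: h2 => //; apply: ltn_trans jk.
Qed.

Lemma rot_down_up I v i j : ideal I -> free I v i -> free I v j -> (i < j)%N ->
  rot_down I v i -> rot_down I v j.
Proof.
move=> hI fi fj ij /asboolP[h|[k fk [ki Ik]]]; apply/asboolP; first by left.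
by right; exists k => //; split=> //; apply: ltn_trans ij.
Qed.

Lemma not_free I v i : (i < m)%N -> (c i).1 = v -> ~ free I v i ->
  exists j, [/\ (j < m)%N, ~~ star v (c j).1 & I j = (j < i)%N].
Proof.
move=> im ci nf; apply: contrapT => h; apply: nf; split=> // j jm hj.
have ji : j != i by apply: contraNneq hj => ->; rewrite ci star_refl.
have : I j <> (j < i)%N by move=> E; apply: h; exists j.
by case: (I j); case: ltngtP ji.
Qed.

(** The delicate case is that of two positions labelled [l.1] of which just one is free: a blocking
    position showing that the other is not free must lie strictly between them, and the ideal
    property of [I] at that position decides. *)
Lemma ideal_act l I : ideal I -> ideal (act l I).
Proof.
move=> hI i j /andP[ij jm] + ne; have im := ltn_trans ij jm.
case: l => v b; have blk k : (c k).1 != v -> act (v, b) I k = I k.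
  exact: (@act_label (v, b)).
have [ci|ci] := eqVneq (c i).1 v; have [cj|cj] := eqVneq (c j).1 v.
- have [fi|nfi] := pselect (free I v i); have [fj|nfj] := pselect (free I v j).
  + rewrite /act /= !asboolT // (free_sign fi fj).
    by case: eqP => _; [apply: rot_up_up|apply: rot_down_up].
  + rewrite /act /= (asboolT fi) asboolF // => _.
    have [k [km hk Ik]] := not_free jm cj nfj.
    case: fi => _ _ /(_ _ km hk); rewrite Ik => kij.
    have /andP[ik kj] : (i < k < j)%N.
      have kj' : (c k).1 != (c j).1.
        by apply: contraNneq hk => ->; rewrite cj star_refl.
      have : k != j by apply: contraNneq kj' => ->.
      lia.
    apply: (hI k); rewrite ?kj ?Ik // cj.
    by apply: contra hk; rewrite e_sym /star => ->; rewrite orbT.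
  + rewrite /act /= asboolF // (asboolT fj) => Ii.
    have [k [km hk Ik]] := not_free im ci nfi.
    case: fj => _ _ /(_ _ km hk); rewrite Ik => kij.
    have /andP[ik kj] : (i < k < j)%N.
      have ki' : (c k).1 != (c i).1.
        by apply: contraNneq hk => ->; rewrite ci star_refl.
      have kj' : (c k).1 != (c j).1.
        by apply: contraNneq hk => ->; rewrite cj star_refl.
      have : k != j by apply: contraNneq kj' => ->.
      have : k != i by apply: contraNneq ki' => ->.
      lia.
    have : I k.
      apply: (hI i) => //; first by rewrite ik.
      by rewrite ci; apply: contra hk; rewrite /star => ->; rewrite orbT.
    by rewrite Ik ltnNge (ltnW ik).
  + by rewrite /act /= !asboolF // => Ii; apply: hI ne => //; rewrite ij.
- rewrite (blk j) // /act /=; case: asboolP => [[_ _ h] _|_ Ii].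
    rewrite h // /star negb_or eq_sym cj; by rewrite ci in ne.
  by apply: hI ne => //; rewrite ij.
- rewrite (blk i) // => Ii; rewrite /act /=; case: asboolP => [[_ _ h]|_].
    have : I i = (j < i)%N.
      by apply: h => //; rewrite /star negb_or eq_sym ci -cj e_sym.
    by rewrite Ii ltnNge (ltnW ij).
  by apply: hI ne => //; rewrite ij.
- by rewrite !blk // => Ii; apply: hI ne => //; rewrite ij.
Qed.

Lemma act_ext v b I J i : (c i).1 = v -> free I v = free J v ->
  (forall j, (c j).1 = v -> I j = J j) -> act (v, b) I i = act (v, b) J i.
Proof.
move=> ci fE IJ; rewrite /act /= fE IJ // /rot_up /rot_down fE.
case: asboolP => // _; case: eqP => _; congr (`[< _ >]).
  rewrite propeqE; split=> -[[j fj Ij] h]; split.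
  - by exists j => //; case: fj (Ij) => _ cj _; rewrite IJ.
  - by move=> k fk /(h _ fk); case: fk => _ ck _; rewrite IJ.
  - by exists j => //; case: fj (Ij) => _ cj _; rewrite IJ.
  - by move=> k fk /(h _ fk); case: fk => _ ck _; rewrite IJ.
rewrite propeqE; split=> -[h|[j fj [ji Ij]]].
- by left=> j fj; have := h _ fj; case: fj => _ cj _; rewrite IJ.
- by right; exists j => //; split=> //; case: fj => _ cj _; rewrite -IJ.
- by left=> j fj; have := h _ fj; case: fj => _ cj _; rewrite IJ.
- by right; exists j => //; split=> //; case: fj => _ cj _; rewrite IJ.
Qed.

(** Each letter moves only positions with its own label, and leaves the free positions of the other
    unchanged. *)
Lemma act_comm u v b b' I : e u v ->
  act (u, b) (act (v, b') I) = act (v, b') (act (u, b) I).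
Proof.
move=> euv; apply/funext => i.
have uv : u != v by apply: contraTneq euv => ->; rewrite e_irr.
have su : star u v by rewrite /star euv orbT.
have sv : star v u by rewrite /star e_sym euv orbT.
have [ci|ci] := eqVneq (c i).1 u.
  rewrite [RHS]act_label /= ?ci //; apply: act_ext; rewrite ?free_act //.
  by move=> j cj; rewrite act_label /= ?cj.
rewrite [LHS]act_label //=; have [ci'|ci'] := eqVneq (c i).1 v.
  apply: act_ext; rewrite ?free_act // => j cj.
  by rewrite act_label //= cj eq_sym.
by rewrite !act_label.
Qed.

Lemma run_cat w1 w2 I : run (w1 ++ w2) I = run w1 (run w2 I).
Proof. exact: foldr_cat. Qed.

Lemma ideal_run w I : ideal I -> ideal (run w I).
Proof. by move=> hI; elim: w => //= l w IH; apply: ideal_act. Qed.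

Lemma run_cong w1 w2 : raag_cong e w1 w2 ->
  forall I, ideal I -> run w1 I = run w2 I.
Proof.
elim=> {w1 w2} [|w1 w2 _ IH I hI|w1 w2 w3 _ IH1 _ IH2 I hI||v b I hI|u v euv I _].
- by [].
- by rewrite IH.
- by rewrite IH1 ?IH2.
- move=> w1 w1' w2 w2' _ IH1 _ IH2 I hI.
  by rewrite !run_cat IH2 // IH1 //; apply: ideal_run.
- by rewrite /= -{1}[b]negbK actK.
- by rewrite /= act_comm.
Qed.

Lemma pi_filter (P : pred nat) (s : seq nat) : sorted ltn s ->
  {in s &, forall i j, (i < j)%N -> P j -> ~~ P i -> star (c i).1 (c j).1} ->
  pi (map c s) = pi (map c [seq i <- s | P i]) * pi (map c [seq i <- s | ~~ P i]).
Proof.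
elim: s => [|i s IH] /= srt h; first by rewrite mul1g.
have hs j : j \in s -> (i < j)%N.
  by move=> js; have /allP := order_path_min ltn_trans srt; apply.
have {}IH := IH (path_sorted srt) (sub_in2 (fun j => @mem_behead _ (i :: s) j) h).
case: ifPn => Pi /=; first by rewrite raag_pi_cons IH mulgA -raag_pi_cons.
rewrite raag_pi_cons IH [in RHS](raag_pi_cons _ (c i)) !mulgA; congr (_ * _).
apply: commute_letter_word => //; apply/allP => l /mapP[j].
rewrite mem_filter => /andP[Pj js ->]; apply: h => //; rewrite ?mem_head //.
  by rewrite inE js orbT.
exact: hs.
Qed.

(** The free positions in the set can be moved to the front, where they spell a power of [gen v],
    which commutes with [x]. The action changes nothing else. *)
Lemma ideal_elt_act (x : raag e) v b I : commute x (gen v) ->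
  x ^ ideal_elt (act (v, b) I) = x ^ ideal_elt I.
Proof.
move=> xv; pose F := fun i => `[< free I v i >].
have key J : free J v = free I v -> x ^ ideal_elt J =
    x ^ pi (map c [seq i <- iota 0 m | ~~ F i && J i]).
  move=> fE; rewrite /ideal_elt (pi_filter (P := F)); last first.
  - move=> i j; rewrite !mem_filter !mem_iota /= => /andP[Ji im] _ ij.
    rewrite /F -fE => /asboolP[jm cj hj] _; rewrite cj star_sym //.
    apply/negPn/negP => h; have := hj _ im h.
    by rewrite Ji ltnNge (ltnW ij).
  - apply: sorted_filter; [exact: ltn_trans|exact: iota_ltn_sorted].
  rewrite -!filter_predI conjgM; congr (_ ^ _).
  suff h : commute x (pi [seq c i | i <- iota 0 m & predI F J i]).
    by rewrite conjgE h mulKg.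
  apply: commute_word => l /mapP[j]; rewrite mem_filter => /andP[/andP[]].
  move=> /asboolP[_ cj _] _ _ ->.
  case: (c j) cj => u b' /= ->; rewrite raag_pi_letter.
  by case: b' => //; apply: commuteV.
rewrite (key _ erefl) (key _ (free_actv v b I)).
congr (_ ^ pi (map c _)); apply: eq_filter => i; rewrite /F /act.
by case: asboolP.
Qed.

Lemma ideal_empty : ideal (fun=> false). Proof. by []. Qed.

(** The word is read from its end. When position [n] is reached, the set built so far is the part of
    [I] beyond [n]; then [n] is the last free position missing, and [rot_up] adds exactly it. *)
Lemma run_ideal I : ideal I ->
  run [seq c i | i <- iota 0 m & I i] (fun=> false) = fun i => (i < m)%N && I i.
Proof.
move=> hI.
suff key k : (k <= m)%N -> run [seq c i | i <- iota (m - k) k & I i] (fun=> false)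
    = fun i => [&& (m - k <= i)%N, (i < m)%N & I i].
  by have := key m (leqnn m); rewrite subnn => ->.
elim: k => [_|k IH km]; first by apply/funext => i /=; case: ltnP => /=; lia.
have mk : (m - k.+1).+1 = (m - k)%N by lia.
set n := (m - k.+1)%N in mk *; have nm : (n < m)%N by lia.
rewrite /= mk; case: ifPn => In; rewrite /= IH ?(ltnW km) //; last first.
  apply/funext => i; rewrite -mk.
  have [->|] := eqVneq i n; first by rewrite ltnn (negbTE In) !andbF.
  by rewrite [(n <= i)%N]leq_eqVlt [n == i]eq_sym => /negbTE ->.
set J := fun i => _.
have fn : free J (c n).1 n.
  split=> // j jm hj; rewrite /J -mk jm /=; case: ltnP => //= nj.
  apply: (hI n) => //; first by rewrite nj.
  by apply: contra hj; rewrite /star => ->; rewrite orbT.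
have above j : free J (c n).1 j -> (n < j)%N -> I j.
  move=> [jm cj _] nj; apply: (hI n) => //; first by rewrite nj.
  by rewrite cj e_irr.
apply/funext => i; rewrite /act; case: asboolP => fi; last first.
  have ni : n != i by apply: contra_notN fi => /eqP <-.
  by rewrite /J -mk [in RHS]leq_eqVlt (negbTE ni).
rewrite (free_sign fi fn) eqxx; case: (fi) => im _ _; rewrite im /=.
case: (ltngtP n i) => [ni|ni|<-]; rewrite ?In /=.
- rewrite above //; apply/asboolP; split.
    by exists n => //; rewrite /J -mk ltnn.
  move=> j fj ij; rewrite /J -mk (ltn_trans ni ij) above ?(ltn_trans ni) // andbT.
  by case: fj.
- apply/asboolPn => -[_ /(_ _ fn ni)]; by rewrite /J -mk ltnn.
- apply/asboolP; split; first by exists n => //; rewrite /J -mk ltnn.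
  by move=> j fj nj; rewrite /J -mk nj above // andbT; case: fj.
Qed.

Definition ideal_elts : set (raag e) :=
  [set h | exists2 I, ideal I & h = ideal_elt I].

(** The orbit map of the empty ideal, read back in the group; by [run_cong] any word for [h] may
    replace [repr h]. *)
Definition gate (h : raag e) := ideal_elt (run (repr h) (fun=> false)).

Lemma gate_pi w : gate (pi w) = ideal_elt (run w (fun=> false)).
Proof.
by congr ideal_elt; apply: (run_cong _ ideal_empty); apply: raag_reprP.
Qed.

Lemma gate_in h : ideal_elts (gate h).
Proof. by exists (run (repr h) (fun=> false)) => //; apply: ideal_run. Qed.

Lemma gate_id h : ideal_elts h -> gate h = h.
Proof.
move=> [I hI ->]; rewrite gate_pi run_ideal //; congr (pi (map c _)).
by apply: eq_in_filter => i; rewrite mem_iota => /= ->.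
Qed.

Lemma gate_conj (x h : raag e) v b : commute x (gen v) ->
  x ^ gate (pi [:: (v, b)] * h) = x ^ gate h.
Proof.
by move=> xv; rewrite -[h]raag_piK -raag_pi_cat !gate_pi ideal_elt_act.
Qed.

End Ideals.

(** By [run_ideal] a reduced word sends the empty ideal to the set of all its positions, whereas a
    word for 1 fixes the empty ideal. *)
Lemma reduced_neq1 (V : choiceType) (e : rel V) (w : raag_word V) :
  symmetric e -> irreflexive e -> reduced e w -> raag_pi e w = 1 -> w = [::].
Proof.
move=> e_sym e_irr; case: w => // l w' hw.
set w := l :: w' in hw * => /raag_piP wE; pose c := nth l w; pose m := size w.
have c_red i j : (i < j < m)%N -> c j = inv_letter (c i) ->
  exists2 k, (i < k < j)%N & ~~ star e (c i).1 (c k).1 by apply: reduced_nth.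
have := run_cong e_sym e_irr c_red wE (@ideal_empty _ e c m).
have := run_ideal e_irr c_red (I := xpredT) (fun _ _ _ _ _ => isT).
rewrite filter_predT -/(mkseq c m) mkseq_nth => ->.
by move=> /(congr1 (fun f => f 0%N)).
Qed.

(** * Centralizers of generators and edges of the extension graph *)

Section ExtensionGraphEdges.
Variables (V : choiceType) (e : rel V).
Hypotheses (e_sym : symmetric e) (e_irr : irreflexive e).
Implicit Types (u v : V) (x y g h k : raag e) (l : V * bool).

Notation pi := (raag_pi e).
Notation gen := (raag_gen e).
Notation star := (star e).

(** The subgroup generated by the star of [v]; by [conj_in_star] and [gen_conj_eq] it is the
    centralizer of [gen v]. *)
Definition in_star v k := exists2 w : raag_word V,
  all (fun l => star v l.1) w & k = pi w.

Lemma in_starM v g h : in_star v g -> in_star v h -> in_star v (g * h).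
Proof.
move=> [w hw ->] [w' hw' ->]; exists (w ++ w'); last by rewrite raag_pi_cat.
by rewrite all_cat hw.
Qed.

Lemma conj_in_star v k : in_star v k -> gen v ^ k = gen v.
Proof.
by move=> [w hw ->]; rewrite conjgE (commute_gen_word hw) mulKg.
Qed.

Lemma commute_conj x y g : commute (x ^ g) (y ^ g) -> commute x y.
Proof. by rewrite /commute -!conjMg => /conjg_inj. Qed.

Lemma commute_gen_star v u : commute (gen v) (gen u) -> star v u.
Proof.
move=> vu; apply/negPn/negP => nst.
pose w := [:: (v, true); (u, true); (v, false); (u, false)].
have w1 : pi w = 1.
  rewrite /w !raag_pi_cons_gen raag_pi_nil mulg1 mulgA vu -!mulgA.
  by rewrite mulVKg mulgV.
suff red : reduced e w by have := reduced_neq1 e_sym e_irr red w1.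
move: nst; rewrite /star negb_or => /andP[/negbTE vu1 /negbTE vu2].
rewrite /w /= /inv_letter /= /star !xpair_eqE /= !andbF !andbT [u == v]eq_sym.
by rewrite (e_sym u v) vu1 vu2.
Qed.

(** Write [k] as a product [S K T] with [S] over the star of [v], [T] over the star of [u] and [K]
    shortest. If [K] were nonempty, no first letter of it could move into [S] and no last letter
    into [T], which makes a word for the commutator of [gen v ^ pi K] and [gen u] reduced. *)
Lemma commute_conj_gen v u k : commute (gen v ^ k) (gen u) ->
  star v u /\ exists s t, [/\ in_star v s, in_star u t & k = s * t].
Proof.
move=> vku; pose P n := `[< exists S K T, [/\ size K = n,
  all (fun l => star v l.1) S, all (fun l => star u l.1) T &
  k = pi S * pi K * pi T] >].
have exP : exists n, P n.
  exists (size (repr k)); apply/asboolP; exists [::], (repr k), [::].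
  by split=> //; rewrite mul1g mulg1 raag_piK.
case: (ex_minnP exP) => _ /asboolP[S [K [T [<- hS hT kE]]]] minK.
have min S' K' T' : all (fun l => star v l.1) S' ->
    all (fun l => star u l.1) T' ->
    k = pi S' * pi K' * pi T' -> (size K <= size K')%N.
  by move=> hS' hT' kE'; apply: minK; apply/asboolP; exists S', K', T'.
have {vku} vKu : commute (gen v ^ pi K) (gen u).
  apply: (@commute_conj _ _ (pi T)); rewrite -conjgM.
  rewrite (@conj_in_star u (pi T)); last by exists T.
  have <- : gen v ^ k = gen v ^ (pi K * pi T); last by [].
  by rewrite kE -mulgA conjgM (@conj_in_star v (pi S)) //; exists S.
case: K => [|l0 K0] in kE min minK vKu *.
  split; first by apply: commute_gen_star; rewrite conjg1 in vKu.
  by exists (pi S), (pi T); split; [exists S|exists T|rewrite kE mulg1].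
set K := l0 :: K0 in kE min minK vKu *; exfalso.
have redK : reduced e K.
  apply/negPn/negP => /not_reduced_shorten[K' [KE ltK]].
  by move: ltK; rewrite ltnNge (min S K' T) // KE.
have F2 l : starts e l K -> ~~ star v l.1.
  move=> /starts_factor[K' [KE ltK]]; apply/negP => hl.
  move: ltK; rewrite ltnNge (min (rcons S l) K' T) //.
    by rewrite all_rcons hl.
  by rewrite -cats1 raag_pi_cat -(mulgA (pi S)) -KE.
have F3 l : ends e l K -> ~~ star u l.1.
  move=> /ends_factor[K' [KE ltK]]; apply/negP => hl.
  move: ltK; rewrite ltnNge (min S K' (l :: T)) //=.
    by rewrite hl.
  by rewrite (raag_pi_cons _ l T) !mulgA -(mulgA (pi S)) -KE.
have notv : ~~ all (fun l => star v l.1) K.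
  apply/negP => /= /andP[h _]; have : starts e l0 K by rewrite /= eqxx.
  by move/F2; rewrite h.
have notu : ~~ all (fun l => star u l.1) K.
  rewrite -all_rev; case E : (rev K) => [|l r].
    by move/(congr1 size): E; rewrite size_rev.
  apply/negP => /= /andP[h _]; have : ends e l K by rewrite /ends E /= eqxx.
  by move/F3; rewrite h.
have all_inv w a : all (fun l => star a l.1) (raag_word_inv w) =
    all (fun l => star a l.1) w.
  by rewrite /raag_word_inv all_rev all_map.
pose B b := raag_word_inv K ++ (v, b) :: K.
have redB b : reduced e (B b).
  apply: reduced_cat; first by rewrite reduced_inv.
    by apply/andP; split=> //; apply/negP => /F2; rewrite star_refl.
  move=> l; rewrite ends_inv => hl; have := F2 _ hl => /= nl.
  apply/negP => /orP[/eqP E|]; last by rewrite star_sym // (negbTE nl).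
  by rewrite /= (_ : l.1 = v) ?star_refl // in nl; case: (l) E => ? ? [].
have endsB b l : ends e l (B b) -> ends e l K.
  rewrite /B -cat1s catA ends_cat => /orP[//|/andP[lK]].
  rewrite ends_cat => /orP[|/andP[/= lv]].
    rewrite /ends /= andbF orbF => /eqP lE; rewrite -lE in lK.
    by case/negP: notv.
  rewrite ends_inv => /F2; rewrite star_sym //=; by case/andP: lv => ->.
have startsB b l : starts e l (B b) -> ends e (inv_letter l) K.
  rewrite /B starts_cat starts_inv => /orP[//|/andP[]].
  rewrite all_inv => lK /orP[/eqP lE|/andP[lv /F2]].
    by rewrite -lE in lK; case/negP: notv.
  by rewrite star_sym // lv.
pose C b := B b ++ [:: (u, b)].
have redC b : reduced e (C b).
  apply: reduced_cat => // l /endsB/F3 nl; apply/negP => /=.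
  rewrite andbF orbF => /eqP E.
  by rewrite (_ : l.1 = u) ?star_refl // in nl; case: (l) E => ? ? [].
have endsC b l : ends e l (C b) -> l = (u, b).
  rewrite /C ends_cat => /orP[|/andP[/= + /endsB/F3]].
    by rewrite /ends /= andbF orbF => /eqP.
  by rewrite andbT star_sym // => ->.
(* This word spells the commutator. *)
suff red : reduced e (C true ++ C false).
  have := reduced_neq1 e_sym e_irr red.
  have piC b : pi (C b) = (if b then gen v else (gen v)^-1) ^ pi K *
      (if b then gen u else (gen u)^-1).
    by rewrite /C /B !raag_pi_cat raag_pi_inv !raag_pi_cons_gen raag_pi_nil mulg1.
  suff -> : pi (C true ++ C false) = 1.
    by move=> /(_ erefl)/(congr1 size); rewrite !size_cat /= addn1.
  by rewrite raag_pi_cat !piC conjVg vKu -mulgA mulVKg mulgV.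
apply: reduced_cat => // l /endsC ->; rewrite /C starts_cat negb_or.
apply/andP; split.
  by apply/negP => /startsB/F3; rewrite star_refl.
have {}notu : ~~ all (fun l => star (inv_letter (u, true)).1 l.1) K by [].
by rewrite /B all_cat all_inv (negbTE notu).
Qed.

Lemma gen_inj : injective gen.
Proof.
move=> v u vu; apply/eqP/negPn/negP => ne.
pose w := [:: (v, true); (u, false)].
have w1 : pi w = 1 by rewrite /w !raag_pi_cons_gen raag_pi_nil mulg1 vu mulgV.
suff red : reduced e w by have := reduced_neq1 e_sym e_irr red w1.
by rewrite /w /= /inv_letter /= xpair_eqE andbF eq_sym (negbTE ne) orbF.
Qed.

(** Equal elements commute, so [commute_conj_gen] applies. This makes maps defined on vertices
    through a choice of conjugator well defined. *)
Lemma gen_conj_eq v u h k : gen v ^ h = gen u ^ k ->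
  v = u /\ exists2 s, in_star v s & h = s * k.
Proof.
move=> E; have {}E : gen v ^ (h * k^-1) = gen u by rewrite conjgM E conjgK.
have [|_ [s [t [vs ut hk]]]] := @commute_conj_gen v u (h * k^-1).
  by rewrite E; exact: commute_refl.
have vu : v = u.
  apply: gen_inj; apply: (@conjg_inj _ t).
  by rewrite (conj_in_star ut) -E hk conjgM (conj_in_star vs).
split=> //; exists (s * t); last by rewrite -hk mulgVK.
by apply: in_starM => //; rewrite vu.
Qed.

(** If [h * k^-1 = s * t] with [s] centralizing [gen v] and [t] centralizing [gen u], then [t * k]
    is a common conjugator for [gen v ^ h] and [gen u ^ k]. *)
Lemma ext_adjP x y : ext_adj x y <->
  exists v u h, [/\ e v u, x = gen v ^ h & y = gen u ^ h].
Proof.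
rewrite /ext_adj; split.
  move=> /and4P[/set_mem[v [h ->]] /set_mem[u [k ->]] ne /eqP vu].
  have [] := @commute_conj_gen v u (h * k^-1).
    by apply: (@commute_conj _ _ k); rewrite -conjgM mulgVK.
  move=> st [s [t [vs ut hk]]]; have hE : h = s * (t * k).
    by rewrite mulgA -hk mulgVK.
  have uE : gen u ^ k = gen u ^ (t * k) by rewrite conjgM (conj_in_star ut).
  have vE : gen v ^ h = gen v ^ (t * k).
    by rewrite hE conjgM (conj_in_star vs).
  exists v, u, (t * k); split=> //; case/orP: st => // /eqP E.
  by rewrite uE vE E eqxx in ne.
move=> [v [u [h [vu -> ->]]]]; apply/and4P; split.
- by apply/mem_set; exists v, h.
- by apply/mem_set; exists u, h.
- apply/eqP => /conjg_inj/gen_inj E.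
  by rewrite E e_irr in vu.
- by apply/eqP; rewrite -!conjMg commute_gen // /star vu orbT.
Qed.

End ExtensionGraphEdges.

(** * Walks and the edge metric *)

Section Walks.
Variables (T : Type) (G : sgraph T).

Lemma walk0 x : vset G x -> walk G x x 0.
Proof. by move=> Gx; split=> //; exists [::]. Qed.

Lemma walk1 x y : adj G x y -> walk G x y 1.
Proof.
by move=> xy; split; [exact: adj_vset xy|exists [:: y]; rewrite /= ?xy].
Qed.

Lemma walk_cat x y z m n : walk G x y m -> walk G y z n -> walk G x z (m + n).
Proof.
move=> [Gx [p xp [py pm]]] [_ [q yq [qz qn]]]; split=> //.
exists (p ++ q); first by rewrite cat_path xp py.
by rewrite last_cat py size_cat pm qn.
Qed.

Lemma walk_sym x y n : walk G x y n -> walk G y x n.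
Proof.
move=> [Gx [p xp [py pn]]]; split.
  elim: p x Gx xp py {pn} => [x Gx _ <- //|z p IH x _ /= /andP[xz zp]].
  by apply: IH zp; apply: (@adj_vset _ G z x); rewrite adj_sym.
exists (rev (belast x p)); last first.
  split; last by rewrite size_rev size_belast.
  by case: p {xp pn} py => //= z p _; rewrite rev_cons last_rcons.
rewrite -py rev_path; congr is_true: xp; apply: eq_path => a b.
by rewrite adj_sym.
Qed.

Lemma walk_subgraph (H : sgraph T) x y n : subgraph H G ->
  walk H x y n -> walk G x y n.
Proof.
move=> [HG1 HG2] [Hx [p xp pE]]; split; first exact: HG1.
by exists p => //; apply: sub_path xp.
Qed.

End Walks.

(** The walk makes the infimum finite, so [fine] does not return its default value. *)
Lemma edge_dist_le (R : realType) (T : Type) (G : sgraph T) x y n :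
  walk G x y n -> (0 <= fine (edge_dist R G x y) <= n%:R)%R.
Proof.
move=> w.
have h0 : (0%:E <= edge_dist R G x y)%E.
  by apply/ereal_infP => _ [k _ <-]; rewrite lee_fin ler0n.
have h1 : (edge_dist R G x y <= n%:R%:E)%E.
  by apply: ge_ereal_inf; exists n%:R%:E => //; exists n.
rewrite -!lee_fin fineK ?h0 //.
by rewrite fin_numE; case: edge_dist h0 h1.
Qed.

Lemma edge_dist_isometric (R : realType) (T : Type) (H G : sgraph T) x y :
  subgraph H G -> (forall n, walk G x y n -> walk H x y n) ->
  edge_dist R H x y = edge_dist R G x y.
Proof.
move=> HG GH; rewrite /edge_dist; congr (ereal_inf (_ @` _)).
by apply/seteqP; split=> n; [apply: walk_subgraph|apply: GH].
Qed.

(** * Gated sets and isometrically embedded subgraphs *)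

Section SpannedSubgraphs.
Variables (V : choiceType) (e : rel V).
Hypotheses (e_sym : symmetric e) (e_irr : irreflexive e).
Implicit Types (u v : V) (x y g h k : raag e) (l : V * bool).
Implicit Types (Y Z : set (raag e)).

Notation pi := (raag_pi e).
Notation gen := (raag_gen e).
Notation star := (star e).

Definition spanned_vset Y : set (raag e) :=
  [set x | exists v h, Y h /\ x = gen v ^ h].

Definition spanned_adj Y : rel (raag e) := fun x y =>
  `[< exists v u h, [/\ Y h, e v u, x = gen v ^ h & y = gen u ^ h] >].

Lemma spanned_sym Y : symmetric (spanned_adj Y).
Proof.
move=> x y; apply/asboolP/asboolP => -[v [u [h [Yh vu -> ->]]]];
  by exists u, v, h; rewrite e_sym.
Qed.

Lemma spanned_irr Y : irreflexive (spanned_adj Y).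
Proof.
move=> x; apply/asboolPn => -[v [u [h [_ vu ->]]]].
by move=> /conjg_inj/(gen_inj e_sym e_irr) E; rewrite E e_irr in vu.
Qed.

Lemma spanned_adj_vset Y x y : spanned_adj Y x y -> spanned_vset Y x.
Proof. by move=> /asboolP[v [u [h [Yh _ -> _]]]]; exists v, h. Qed.

(* The union of the copies of Gamma conjugated by the elements of [Y]. *)
Definition spanned Y : sgraph (raag e) :=
  SGraph (@spanned_sym Y) (@spanned_irr Y) (@spanned_adj_vset Y).

Lemma spanned_sub Y Z : Y `<=` Z -> subgraph (spanned Y) (spanned Z).
Proof.
move=> YZ; split=> [_ [v [h [/YZ Zh ->]]]|x y]; first by exists v, h.
move=> /asboolP[v [u [h [/YZ Zh vu -> ->]]]].
by apply/asboolP; exists v, u, h.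
Qed.

Lemma spanned_ext Y : subgraph (spanned Y) (ext_graph e).
Proof.
split=> [_ [v [h [_ ->]]]|x y]; first by exists v, h.
move=> /asboolP[v [u [h [_ vu -> ->]]]].
by apply/(ext_adjP e_sym e_irr); exists v, u, h.
Qed.

(* Since [v ^ (k * h) = v ^ h] for [k] in the star of [v], such a [p] induces
   a retraction [v ^ h |-> v ^ p h] of the extension graph onto [spanned Y]. *)
Definition gated Y := exists p : raag e -> raag e,
  [/\ forall h, Y (p h), forall h, Y h -> p h = h &
   forall v l h, star v l.1 -> gen v ^ p (pi [:: l] * h) = gen v ^ p h].

Lemma gated_ideal_elts (c : nat -> V * bool) m :
  (forall i j, (i < j < m)%N -> c j = inv_letter (c i) ->
    exists2 k, (i < k < j)%N & ~~ star (c i).1 (c k).1) ->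
  gated (ideal_elts c m).
Proof.
move=> c_red; exists (gate c m); split=> [h|h hm|v [u b] h vu].
- exact: gate_in.
- exact: gate_id.
- exact/gate_conj/commute_gen.
Qed.

Lemma gated_translate Y g : gated Y -> gated ((fun h => h * g) @` Y).
Proof.
move=> [p [pY pid pst]]; exists (fun h => p (h * g^-1) * g); split.
- by move=> h; exists (p (h * g^-1)).
- by move=> _ [h Yh <-]; rewrite mulgK pid.
- by move=> v l h vl; rewrite !(conjgM, =^~ mulgA) pst.
Qed.

(** The retraction maps edges to edges and fixes both ends, so it carries the walk to one of the
    same length. *)
Lemma gated_walk Y x y n : gated Y -> spanned_vset Y x -> spanned_vset Y y ->
  walk (ext_graph e) x y n -> walk (spanned Y) x y n.
Proof.
move=> [p [pY pid pst]] Yx Yy [_ [s xs [sy sn]]].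
have pS v k h : in_star v k -> gen v ^ p (k * h) = gen v ^ p h.
  move=> [w hw ->]; elim: w hw => [|l w IH] /=; first by rewrite mul1g.
  by move=> /andP[vl /IH]; rewrite raag_pi_cons -mulgA pst.
(* For a vertex [x] the set [S x] is a singleton by [gen_conj_eq]; elsewhere [r] is the identity by
   default. *)
pose S x := [set z | exists v h, x = gen v ^ h /\ z = gen v ^ p h].
pose r x := xget x (S x).
have rE v h : r (gen v ^ h) = gen v ^ p h.
  apply: xget_unique; first by exists v, h.
  move=> _ [u [k [E ->]]]; have [E' [s' uS ->]] := gen_conj_eq e_sym e_irr E.
  by rewrite -E' pS.
have rid z : spanned_vset Y z -> r z = z.
  by move=> [v [h [Yh ->]]]; rewrite rE pid.
split=> //; exists (map r s); last first.
  by rewrite -{1}(rid _ Yx) last_map sy rid // size_map.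
rewrite -(rid _ Yx) path_map; apply: sub_path xs => a b.
move=> /(ext_adjP e_sym e_irr)[v [u [h [vu -> ->]]]].
by apply/asboolP; exists v, u, (p h); rewrite !rE.
Qed.

(** Two given vertices lie in a single gated piece of [Y], and every walk between them retracts onto
    that piece. *)
Lemma weakly_convex_spanned (R : realType) Y :
  (forall h k, Y h -> Y k ->
     exists Z, [/\ gated Z, Z `<=` Y, Z h & Z k]) ->
  weakly_convex R (spanned Y) (ext_graph e).
Proof.
move=> dir; split=> [|x y [v [h [Yh ->]]] [u [k [Yk ->]]]].
  exact: spanned_ext.
have [Z [gZ ZY Zh Zk]] := dir _ _ Yh Yk.
apply: edge_dist_isometric => [|n w]; first exact: spanned_ext.
apply: (walk_subgraph (spanned_sub ZY)); apply: gated_walk w => //.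
  by exists v, h.
by exists u, k.
Qed.

Lemma ext_vset_conj x g : ext_vset x -> ext_vset (x ^ g).
Proof. by move=> [v [h ->]]; exists v, (h * g); rewrite conjgM. Qed.

Lemma ext_walk_conj x y g n : walk (ext_graph e) x y n ->
  walk (ext_graph e) (x ^ g) (y ^ g) n.
Proof.
move=> [Gx [s xs [sy sn]]]; split; first exact: ext_vset_conj.
exists (map (fun z => z ^ g) s).
  rewrite (path_map (f := fun z => z ^ g)); apply: sub_path xs => a b.
  move=> /(ext_adjP e_sym e_irr)[v [u [h [vu -> ->]]]].
  by apply/(ext_adjP e_sym e_irr); exists v, u, (h * g); rewrite !conjgM.
by rewrite (last_map (fun z => z ^ g)) sy size_map.
Qed.

Lemma ext_adj_gen v u h : e v u -> ext_adj (gen v ^ h) (gen u ^ h).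
Proof. by move=> vu; apply/(ext_adjP e_sym e_irr); exists v, u, h. Qed.

End SpannedSubgraphs.

(** * Orbits of loxodromic elements *)

Section Loxodromic.
Variables (V : finType) (e : rel V).
Hypotheses (e_sym : symmetric e) (e_irr : irreflexive e).
Hypothesis e_conn : forall u v, connect e u v.
Implicit Types (u v : V) (x y g h k : raag e).

Notation pi := (raag_pi e).
Notation gen := (raag_gen e).
Notation walk := (walk (ext_graph e)).

(** The copies of Gamma conjugated by [pi ((u, b) :: w)] and by [pi w] share the vertex
    [gen u ^ pi w], so the letters of a conjugator can be stripped one by one. *)
Lemma ext_connected x y : ext_vset x -> ext_vset y -> exists n, walk x y n.
Proof.
have tr a b d : (exists n, walk a b n) -> (exists n, walk b d n) ->
    exists n, walk a d n.
  by move=> [m wm] [n wn]; exists (m + n)%N; apply: walk_cat wn.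
have sy a b : (exists n, walk a b n) -> exists n, walk b a n.
  by move=> [n wn]; exists n; apply: walk_sym.
have step v u h : exists n, walk (gen v ^ h) (gen u ^ h) n.
  have /connectP[s vs ->] := e_conn v u.
  elim: s v vs => [|w s IH] v /=.
    by move=> _; exists 0%N; apply: walk0; exists v, h.
  move=> /andP[vw /IH]; apply: tr; exists 1%N; apply: walk1.
  exact: ext_adj_gen.
have base v h : exists n, walk (gen v ^ h) (gen v ^ 1) n.
  rewrite -[h]raag_piK; elim: (repr h) => [|[u b] w IH].
    exact: step.
  apply: (tr _ _ _ (step _ u _)) _.
  rewrite raag_pi_cons conjgM (conj_in_star (v := u) (k := pi [:: (u, b)])).
    exact: (tr _ _ _ (step _ v _) IH).
  by exists [:: (u, b)] => //=; rewrite star_refl.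
move=> [v [h ->]] [u [k ->]].
exact: tr (base v h) (tr _ _ _ (step v u 1) (sy _ _ (base u k))).
Qed.

Lemma bounded_orbit_not_loxodromic (R : realType) g x N : ext_vset x ->
  (forall n, exists2 k, (k <= N)%N & walk x (x ^ (g ^+ n)) k) ->
  ~ loxodromic R g.
Proof.
move=> Gx bnd [y Gy]; rewrite /translation_length.
set d := fun n : nat => _.
have [r wr] := ext_connected Gy Gx.
(* From [y] to [x], along the orbit of [x], and back to the orbit of [y]. *)
pose M := (r + (N + r))%N.
have dle n : (0 <= d n <= M%:R / n%:R)%R.
  have [k kN wk] := bnd n.
  have w : walk y (y ^ (g ^+ n)) (r + (k + r)).
    apply: (walk_cat wr (walk_cat wk _)).
    by apply: ext_walk_conj => //; exact: walk_sym wr.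
  have /andP[h1 h2] := edge_dist_le R w.
  rewrite /d divr_ge0 ?ler0n //= ler_wpM2r ?invr_ge0 ?ler0n //.
  by apply: le_trans h2 _; rewrite ler_nat leq_add2l leq_add2r.
suff -> : lim (d @ \oo) = 0%R by rewrite ltxx.
apply/cvg_lim; first exact: Rhausdorff.
(* The shift by one turns the bound [M / n] into a multiple of [harmonic]. *)
rewrite -cvg_shiftS.
apply: (@squeeze_cvgr _ _ _ _ (fun=> 0%R) (fun n => M%:R * harmonic n)%R).
- by near=> n; apply: dle.
- exact: cvg_cst.
- rewrite -[X in _ --> X](@mulr0 R M%:R%R); apply: cvgMr; exact: cvg_harmonic.
Unshelve. all: by end_near.
Qed.

End Loxodromic.

Section Powers.
Variables (V : choiceType) (e : rel V).
Implicit Types (x y g h : raag e).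

Lemma cyclic_setP g h : cyclic_set g h <-> exists a b, h = g ^+ a / g ^+ b.
Proof.
split=> [[n [->|->]]|[a [b ->]]].
- by exists n, 0%N; rewrite expg0 invg1 mulg1.
- by exists 0%N, n; rewrite expg0 mul1g.
have [ab|/ltnW ba] := leqP a b.
  by exists (b - a)%N; right; rewrite expgnFr // invgF.
by exists (a - b)%N; left; rewrite expgnFr.
Qed.

Lemma cyclic_setM g x y :
  cyclic_set g x -> cyclic_set g y -> cyclic_set g (x * y).
Proof.
move=> /cyclic_setP[a [b ->]] /cyclic_setP[c [d ->]]; apply/cyclic_setP.
exists (a + c)%N, (d + b)%N; rewrite !expgnDr invgM !mulgA.
rewrite -(mulgA (g ^+ a) (g ^- b)) -(mulgA (g ^+ a) (g ^+ c)); congr (_ * _ * _).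
by apply/commute_sym/commuteV/commuteX2.
Qed.

Lemma cyclic_setV g x : cyclic_set g x -> cyclic_set g x^-1.
Proof. by case=> n [->|->]; exists n; rewrite ?invgK; [right|left]. Qed.

Lemma conjg_expg x g n : x ^ g = x -> x ^ (g ^+ n) = x.
Proof. by move=> xg; elim: n => [|n IH]; rewrite ?conjg1 // expgS conjgM xg. Qed.

End Powers.

Section LoxodromicOrbits.
Variables (V : finType) (e : rel V).
Hypotheses (e_sym : symmetric e) (e_irr : irreflexive e).
Hypothesis e_conn : forall u v, connect e u v.
Variables (R : realType) (g : raag e).
Hypothesis g_lox : loxodromic R g.

(** Otherwise a positive power of [g] fixes [x], whose orbit is then finite and hence bounded. *)
Lemma loxodromic_conj_inj x a b :
  ext_vset x -> cyclic_set g a -> cyclic_set g b ->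
  x ^ a = x ^ b -> a = b.
Proof.
move=> Gx ga gb xab.
suff fix0 t : x ^ (g ^+ t) = x -> t = 0%N.
  have [t tE] := cyclic_setM ga (cyclic_setV gb).
  have xt : x ^ (a / b) = x by rewrite conjgM xab conjgK.
  apply: divg1_eq; case: tE xt => ->; first by move=> /fix0 ->; rewrite expg0.
  move=> /(congr1 (fun z => z ^ (g ^+ t))); rewrite conjgKV => /esym/fix0 ->.
  by rewrite expg0 invg1.
case: t => // t xt; exfalso.
have /choice[L LP] : forall i, exists n, walk (ext_graph e) x (x ^ (g ^+ i)) n.
  by move=> i; apply: ext_connected => //; apply: ext_vset_conj.
apply: (bounded_orbit_not_loxodromic e_sym e_irr e_conn
  (N := \max_(i < t.+1) L i) Gx) g_lox => n.
have nt : (n %% t.+1 < t.+1)%N by rewrite ltn_mod.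
exists (L (n %% t.+1)%N); first exact: (leq_bigmax (Ordinal nt)).
rewrite {1}(divn_eq n t.+1) mulnC expgnDr expgnA conjgM.
by rewrite (conjg_expg _ xt).
Qed.

End LoxodromicOrbits.

(** * The axis of a shortest word among the conjugates *)

Section CyclicWord.
Variables (V : finType) (e : rel V).
Hypotheses (e_sym : symmetric e) (e_irr : irreflexive e).
Variables (g r : raag e) (l0 : V * bool) (w : raag_word V).

Notation pi := (raag_pi e).
Notation gen := (raag_gen e).
Notation star := (star e).
Notation n := (size w).

Hypothesis n_gt0 : (0 < n)%N.
Hypothesis w_conj : pi w * r = r * g.
Hypothesis w_min : forall w' r', pi w' * r' = r' * g -> (n <= size w')%N.

Definition periodic (i : nat) := nth l0 w (i %% n).
Notation c := periodic.

Lemma periodicD i q : c (q * n + i) = c i.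
Proof. by rewrite /c modnMDl. Qed.

Lemma pi_conj_expg k : pi w ^+ k * r = r * g ^+ k.
Proof.
elim: k => [|k IH]; first by rewrite !expg0 mulg1 mul1g.
by rewrite expgSr expgS -mulgA w_conj mulgA IH -mulgA -expgSr expgS.
Qed.

(** Each rotation of [w] also spells a conjugate of [g], so a shortening would contradict
    [w_min]. *)
Lemma rot_reduced k : reduced e (rot k w).
Proof.
apply/negPn/negP => /not_reduced_shorten[w' [piw']].
rewrite size_rot ltnNge (@w_min w' (pi (drop k w) * r)) //.
rewrite piw' /rot raag_pi_cat -mulgA (mulgA (pi (take k w))).
rewrite -[pi (take k w) * _]raag_pi_cat.
by rewrite cat_take_drop w_conj mulgA.
Qed.

Lemma nth_rot k t : (t < n)%N -> nth l0 (rot (k %% n) w) t = c (k + t).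
Proof.
move=> tn; have kn : (k %% n < n)%N by rewrite ltn_mod.
rewrite /rot nth_cat size_drop /c -modnDml; case: ltnP => h.
  by rewrite nth_drop (@modn_small (_ + _)) //; lia.
rewrite nth_take; last by lia.
have -> : (k %% n + t)%N = (1 * n + (t - (n - k %% n)))%N by lia.
by rewrite modnMDl (@modn_small (_ - _)) //; lia.
Qed.

(** Moving [i] forward by whole periods to [i'] brings it less than one period before [j], and then
    both lie in one rotation of [w]. They do not coincide, since no letter is its own inverse. *)
Lemma periodic_reduced i j : (i < j)%N -> c j = inv_letter (c i) ->
  exists2 k, (i < k < j)%N & ~~ star (c i).1 (c k).1.
Proof.
move=> ij cij; pose q := ((j - i) %/ n)%N; pose s := ((j - i) %% n)%N.
pose i' := (q * n + i)%N; have jE : j = (i' + s)%N.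
  by have := divn_eq (j - i) n; rewrite -/q -/s /i'; lia.
have ci : c i' = c i by rewrite periodicD.
have sn : (s < n)%N by rewrite ltn_mod.
have s0 : (0 < s)%N.
  rewrite lt0n; apply/eqP => s0; move: cij; rewrite jE s0 addn0 ci.
  by case: (c i) => a [].
have [||k /andP[k0 ks]] := @reduced_nth _ e (rot (i' %% n) w) l0 0 s
  (rot_reduced _).
- by rewrite s0 size_rot.
- by rewrite !nth_rot // addn0 ci -jE.
rewrite !nth_rot ?(ltn_trans ks) // addn0 ci => h.
by exists (i' + k)%N => //; rewrite jE /i'; lia.
Qed.

Lemma pi_periods p t : pi [seq c i | i <- iota (p * n) (t * n)] = pi w ^+ t.
Proof.
elim: t p => [|t IH] p; first by rewrite mul0n expg0.
rewrite mulSn iotaD map_cat raag_pi_cat expgS; congr (_ * _); last first.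
  by rewrite -mulSnr IH.
rewrite -{1}[(p * n)%N]addn0 iotaDl -map_comp; congr pi.
rewrite -[RHS](mkseq_nth l0); apply/eq_in_map => i.
by rewrite mem_iota /= => ilt; rewrite periodicD /c modn_small.
Qed.

(** The word is the [M]-th power of [w]. Raising [M] alone prepends a period to it; raising [M] and
    [N] together appends one, because [r] conjugates [pi w] to [g]. *)
Definition axis_part M N : set (raag e) :=
  (fun h => h * (r * g ^- N)) @` ideal_elts c (M * n).

Lemma gated_axis_part M N : gated (axis_part M N).
Proof.
apply/gated_translate/gated_ideal_elts => // i j /andP[ij _].
exact: periodic_reduced.
Qed.

Lemma axis_partSl M N : axis_part M N `<=` axis_part M.+1 N.
Proof.
move=> _ [_ [I hI ->] <-]; exists (ideal_elt e c (M * n) I) => //.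
(* The ideal is shifted by one period and the new first period stays empty. *)
exists (fun i => (n <= i)%N && I (i - n)%N).
  move=> i j /andP[ij jm] /andP[ni Ii] ne; rewrite (leq_trans ni (ltnW ij)) /=.
  have cE k : (n <= k)%N -> c k = c (k - n).
    by move=> nk; have := periodicD (k - n) 1; rewrite mul1n subnKC.
  apply: (hI _ _ _ Ii).
    by move: jm; rewrite mulSn; lia.
  by rewrite -!cE //; lia.
rewrite /ideal_elt mulSn iotaD filter_cat.
rewrite (@eq_in_filter _ _ pred0 (iota 0 n)); last first.
  by move=> i; rewrite mem_iota => /andP[_ ilt]; rewrite /= leqNgt ilt.
rewrite filter_pred0 add0n.
have -> : iota n (M * n) = map (addn n) (iota 0 (M * n)).
  by rewrite -iotaDl addn0.
rewrite filter_map -map_comp; congr pi.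
rewrite (@eq_filter _ (preim _ _) I); last first.
  by move=> i /=; rewrite leq_addr addKn.
by apply: eq_map => i /=; have := periodicD i 1; rewrite mul1n.
Qed.

Lemma axis_partS M N : axis_part M N `<=` axis_part M.+1 N.+1.
Proof.
move=> _ [_ [I hI ->] <-]; exists (ideal_elt e c (M * n) I * pi w); last first.
  rewrite -mulgA (mulgA (pi w)) w_conj expgSr invgM -!mulgA.
  by rewrite mulVKg.
(* The new last period is filled completely and contributes the factor [pi w]. *)
exists (fun i => (M * n <= i)%N || I i).
  move=> i j /andP[ij jm] /orP[Mi|Ii] ne.
    by rewrite (leq_trans Mi (ltnW ij)).
  by case: leqP => //= jM; apply: (hI i) => //; rewrite ij.
rewrite /ideal_elt mulSnr iotaD filter_cat map_cat raag_pi_cat add0n.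
congr (pi (map c _) * _).
  by apply: eq_in_filter => i; rewrite mem_iota /= ltnNge => /negbTE ->.
rewrite (@eq_in_filter _ _ predT (iota (M * n) n)) ?filter_predT.
  by have := pi_periods M 1; rewrite mul1n expg1.
by move=> i; rewrite mem_iota => /andP[->].
Qed.

Lemma axis_partD M N a b : axis_part M N `<=` axis_part (M + (b + a)) (N + b).
Proof.
elim: b => [|b IH].
  rewrite add0n addn0; elim: a => [|a IH]; first by rewrite addn0.
  by rewrite addnS; apply: subset_trans IH (@axis_partSl _ _).
by rewrite addSn !addnS; apply: subset_trans IH (@axis_partS _ _).
Qed.

Definition axis : set (raag e) := [set h | exists M N, axis_part M N h].

Lemma axis_directed h k : axis h -> axis k ->
  exists Z, [/\ gated Z, Z `<=` axis, Z h & Z k].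
Proof.
move=> [M [N hh]] [M' [N' kk]].
(* [axis_partD] brings both parts to the shift [N + N'] and then to a common length. *)
exists (axis_part (M + (N' + (M' + N))) (N + N')); split.
- exact: gated_axis_part.
- by move=> x hx; eexists; eexists; exact: hx.
- exact: axis_partD.
- have := @axis_partD M' N' (M + N') N k kk.
  by congr axis_part; lia.
Qed.

Lemma axis_root : axis r.
Proof.
exists 0%N, 0%N; exists 1; last by rewrite expg0 invg1 mulg1 mul1g.
by exists (fun=> false).
Qed.

Lemma axisM h : axis h -> axis (h * g).
Proof.
move=> [M [N /axis_partS[k hk <-]]]; exists M.+1, N; exists k => //.
by rewrite expgS invgM -!mulgA mulVg mulg1.
Qed.

Lemma axisMV h : axis h -> axis (h * g^-1).
Proof.
move=> [M [N [k hk <-]]]; exists M, N.+1; exists k => //.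
by rewrite expgS invgM !mulgA.
Qed.

Lemma axis_cyclic h a : cyclic_set g a -> axis h -> axis (h * a).
Proof.
move=> [t [->|->]]; elim: t h => [|t IH] h hh.
- by rewrite expg0 mulg1.
- by rewrite expgS mulgA; apply/IH/axisM.
- by rewrite expg0 invg1 mulg1.
- by rewrite expgSr invgM mulgA; apply/IH/axisMV.
Qed.

(** The complement graph on the support of [w], connected exactly when the support is not a join.
    Testing the target is enough: paths that start in the support stay there. *)
Definition anticommute : rel V := fun u v => (v \in map fst w) && ~~ e u v.

Hypothesis w_conn : {in map fst w &, forall u v, connect anticommute u v}.

Lemma periodic_mem i : (c i).1 \in map fst w.
Proof. by apply/map_f/mem_nth; rewrite ltn_mod. Qed.

Lemma periodic_occurs v i : v \in map fst w ->
  exists2 j, (i < j <= i + 2 * n)%N & (c j).1 = v.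
Proof.
move=> /(nthP l0.1)[t]; rewrite size_map => tn.
rewrite (nth_map l0) // => tv; exists ((i %/ n).+1 * n + t)%N.
  have := divn_eq i n; have : (i %% n < n)%N by rewrite ltn_mod.
  by rewrite mulSn; lia.
by rewrite periodicD /c modn_small.
Qed.

(** Each step of the path leads to an occurrence of the next letter at most two periods later, which
    belongs to the ideal as it does not commute with the previous one. *)
Lemma ideal_path m I s i j : ideal e c m I -> path anticommute (c i).1 s ->
  I i -> (i + 2 * n * size s < j < m)%N -> ~~ e (last (c i).1 s) (c j).1 -> I j.
Proof.
move=> hI; elim: s i => [|v s IH] i /=.
  by rewrite muln0 addn0 => _ Ii ij ne; apply: hI ne.
move=> /andP[/andP[vw ne] vs] Ii /andP[ij jm].
have [k /andP[ik ki] kv] := periodic_occurs i vw.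
rewrite -kv; apply: IH; rewrite ?kv //.
  by apply: (hI i) => //; [move: ij; rewrite mulnS; lia|rewrite kv].
by rewrite jm andbT; move: ij; rewrite mulnS; lia.
Qed.

Lemma ideal_full m I i j : ideal e c m I -> I i ->
  (i + 2 * n * #|V| < j < m)%N -> I j.
Proof.
move=> hI Ii /andP[ij jm].
have /connectP[s0 s0P jE] := w_conn (periodic_mem i) (periodic_mem j).
(* A path without repeated vertices has fewer than [#|V|] edges. *)
case/shortenP: s0P jE => s sP su _ jE.
apply: (ideal_path hI sP Ii); last by rewrite -jE e_irr.
rewrite jm andbT; apply: leq_trans ij; rewrite ltnS leq_add2l leq_mul2l.
have : (size s < #|V|)%N.
  by rewrite -[_.+1]/(size ((c i).1 :: s)) -(card_uniqP su) max_card.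
by move/ltnW ->; rewrite orbT.
Qed.

Definition axis_bound := ((2 * #|V| + 2) * n)%N.

(** An ideal is empty before its first position [i] and full from a bounded distance after it. The
    full periods at the end form a power of [w], which passes through [r] as a power of [g]; only a
    bounded word remains. *)
Lemma axis_cocompact h : axis h -> exists s : axis_bound.-bseq (V * bool),
  exists2 a, cyclic_set g a & h = pi s * r * a.
Proof.
move=> [M [N [_ [I hI ->] <-]]].
suff [s [t [sb ->]]] : exists s t, (size s <= axis_bound)%N /\
    ideal_elt e c (M * n) I = pi s * pi w ^+ t.
  exists (Bseq sb), (g ^+ t / g ^+ N).
    by apply/cyclic_setP; exists t, N.
  by rewrite /= mulgA -(mulgA _ _ r) pi_conj_expg !mulgA.
have [ex|nex] := pselect (exists i, (i < M * n)%N && I i); last first.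
  exists [::], 0%N; split=> //; rewrite expg0 mulg1 /ideal_elt.
  rewrite (eq_in_filter (a2 := pred0)) ?filter_pred0 // => i.
  rewrite mem_iota /= => im; apply/negbTE/negP => Ii.
  by apply: nex; exists i; rewrite im.
case: (ex_minnP ex) => i /andP[im Ii] imin.
(* The ideal begins in period [q] and is full from period [p] on; the periods beyond [2 * #|V|]
   absorb the rounding of [i]. *)
pose q := (i %/ n)%N; pose p := minn (q + (2 * #|V| + 2)) M.
have iE := divn_eq i n; rewrite -/q in iE.
have imod : (i %% n < n)%N by rewrite ltn_mod.
have qM : (q <= M)%N by rewrite -ltnS /q ltnS ltnW // ltn_divLR.
have pM : (p <= M)%N by rewrite geq_minr.
have qp : (q <= p)%N by rewrite leq_min leq_addr.
exists [seq c i | i <- iota (q * n) ((p - q) * n) & I i], (M - p)%N; split.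
  rewrite size_map size_filter; apply: leq_trans (count_size _ _) _.
  rewrite size_iota leq_mul2r; apply/orP; right.
  by rewrite leq_subLR geq_minl.
rewrite /ideal_elt -(pi_periods p) -raag_pi_cat -map_cat; congr (pi (map c _)).
have -> : (M * n)%N = (q * n + ((p - q) * n + (M - p) * n))%N.
  by rewrite -!mulnDl addnA !subnKC.
rewrite !iotaD !filter_cat add0n -mulnDl subnKC //.
rewrite (@eq_in_filter _ _ pred0 (iota 0 (q * n))); last first.
  move=> k; rewrite mem_iota add0n /= => kq; apply/negbTE/negP => Ik.
  have kM : (k < M * n)%N by apply: leq_trans kq _; rewrite leq_mul2r qM orbT.
  have := imin k; rewrite kM Ik => /(_ isT).
  by rewrite leqNgt (leq_trans kq) // leq_divM.
rewrite filter_pred0 cat0s; congr (_ ++ _).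
rewrite (@eq_in_filter _ _ predT (iota (p * n) _)) ?filter_predT // => k.
rewrite mem_iota -mulnDl subnKC // => /andP[pk kM].
rewrite (ideal_full hI Ii) //= kM andbT.
have pE : p = (q + (2 * #|V| + 2))%N.
  apply/minn_idPl; rewrite leqNgt; apply/negP => /ltnW/minn_idPr Mp.
  by move: (leq_ltn_trans pk kM); rewrite /p Mp ltnn.
apply: leq_trans pk.
rewrite pE {1}iE (mulnDl q) (mulnDl (2 * #|V|)%N) (mulnAC 2 n).
rewrite -addnA ltn_add2l addnC ltn_add2l (leq_trans imod) //.
by rewrite leq_pmull.
Qed.

End CyclicWord.

(** * The axial subgraph of a loxodromic element *)

Section AxialSubgraph.
Variables (V : finType) (e : rel V).
Hypotheses (e_sym : symmetric e) (e_irr : irreflexive e).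
Hypothesis e_conn : forall u v, connect e u v.
Variables (R : realType) (g r : raag e) (w : raag_word V).
Hypothesis g_lox : loxodromic R g.

Notation pi := (raag_pi e).
Notation gen := (raag_gen e).

Hypothesis w_conj : pi w * r = r * g.

(* Otherwise the support of [w] is a join, say of [S1] and [S2]; conjugating
   [u] in [S1] by powers of [w] then yields elements commuting with [S2]. *)
Lemma loxodromic_connected :
  {in map fst w &, forall u v, connect (anticommute e w) u v}.
Proof.
move=> u v uw vw; apply/negPn/negP => uv.
pose far b := (b \in map fst w) && ~~ connect (anticommute e w) u b.
have near_far a b : connect (anticommute e w) u a -> far b -> e a b.
  move=> ua /andP[bw]; apply: contraNT => ab; apply: connect_trans ua _.
  by apply: connect1; rewrite /anticommute bw.
pose P x := forall b, far b -> commute x (gen b).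
have Pw x s : {subset s <= w} -> P x -> P (x ^ pi s).
  elim: s x => [|l s IH] x sw Px; first by rewrite conjg1.
  rewrite raag_pi_cons conjgM; apply: IH => [l' l's|].
    by apply: sw; rewrite inE l's orbT.
  have lw : l.1 \in map fst w by apply/map_f/sw/mem_head.
  have [ul|ul] := boolP (connect (anticommute e w) u l.1); last first.
    have xl : commute x (pi [:: l]).
      have := Px _ (introT andP (conj lw ul)); case: (l) => a [] /=.
        by rewrite raag_pi_letter.
      by rewrite raag_pi_letter => /commuteV.
    by rewrite conjgE xl mulKg.
  move=> b fb; have lb : gen b ^ pi [:: l] = gen b.
    apply: conj_in_star; exists [:: l] => //=.
    by rewrite /star e_sym near_far ?orbT.
  by rewrite /commute -lb -!conjMg (Px b fb).
have fv : far v by rewrite /far vw.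
have uev : e u v by apply: near_far => //; apply: connect0.
have Pn n : P (gen u ^ (pi w ^+ n)).
  elim: n => [|n IH].
    rewrite expg0 conjg1 => b fb; apply: commute_gen.
    by rewrite /star near_far ?orbT //; apply: connect0.
  by rewrite expgSr conjgM; apply: Pw.
(* The bound is 2 because [gen v ^ r] is adjacent to every translate of [gen u ^ r]. *)
apply: (@bounded_orbit_not_loxodromic _ _ e_sym e_irr e_conn R g (gen u ^ r) 2
  _ _ g_lox); first by exists u, r.
move=> n; exists 2%N => //.
have -> : (gen u ^ r) ^ (g ^+ n) = (gen u ^ (pi w ^+ n)) ^ r.
  by rewrite -!conjgM (pi_conj_expg w_conj).
apply: (@walk_cat _ _ _ (gen v ^ r) _ 1 1); apply: walk1.
  exact: ext_adj_gen.
rewrite /= ext_adj_sym /ext_adj; apply/and4P; split.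
- by apply/mem_set; exists u, (pi w ^+ n * r); rewrite conjgM.
- by apply/mem_set; exists v, r.
- apply/eqP => /conjg_inj E.
  have [vu _] : v = u /\ exists2 s, in_star v s & 1 = s * (pi w ^+ n).
    by apply: (gen_conj_eq e_sym e_irr); rewrite conjg1.
  by move: uev; rewrite vu e_irr.
- by apply/eqP; rewrite -!conjMg (Pn n v fv).
Qed.

Variable l0 : V * bool.
Hypothesis w_gt0 : (0 < size w)%N.
Hypothesis w_min : forall w' r', pi w' * r' = r' * g -> (size w <= size w')%N.

Notation Y := (axis g r l0 w).
Notation H := (spanned e_sym e_irr Y).
Notation short := ((axis_bound w).-bseq (V * bool)).

Lemma axis_decomp h : Y h -> exists s : short, exists a,
  [/\ cyclic_set g a, Y (pi s * r) & h = pi s * r * a].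
Proof.
move=> Yh.
have [s [a ga hE]] := axis_cocompact e_irr w_gt0 w_conj loxodromic_connected Yh.
exists s, a; split=> //; rewrite -[pi s * r](mulgK a) -hE.
by apply: axis_cyclic => //; apply: cyclic_setV.
Qed.

(** An edge at [x] comes from a conjugator [pi s * r * a] with [s] short. By [loxodromic_conj_inj]
    the label of [x] and [s] determine [a], which leaves finitely many triples of [s] and two
    labels. *)
Lemma axial_locally_finite : locally_finite H.
Proof.
move=> x _; pose S (p : V * short) := [set h | exists a,
  [/\ cyclic_set g a, h = pi p.2 * r * a & x = gen p.1 ^ h]].
pose f p := xget 1 (S p).
have fE p h : S p h -> f p = h.
  move=> Sh; apply: xget_unique => // h'.
  case: Sh => a [ga hE xE] [a' [ga' hE' xE']].
  rewrite hE hE'; congr (_ * _).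
  apply: (loxodromic_conj_inj e_sym e_irr e_conn g_lox
    (x := gen p.1 ^ (pi p.2 * r))) => //; first by eexists; eexists.
  by rewrite -!conjgM -hE -hE' -xE.
apply: (@sub_finite_set _ _
  ((fun q : V * short * V => gen q.2 ^ f q.1) @` [set: V * short * V])).
  move=> y /asboolP[v [u [h [Yh _ xE ->]]]].
  have [s [a [ga _ hE]]] := axis_decomp Yh.
  by exists ((v, s), u) => //=; rewrite (fE (v, s) h) //; exists a.
exact/finite_image/finite_finset.
Qed.

Lemma axial_preserved : preserved_by g H.
Proof.
have YV h : Y (h * g) -> Y h by move=> /axisMV; rewrite mulgK.
split.
  apply/seteqP; split=> [_ [_ [v [h [Yh ->]]] <-]|_ [v [h [Yh ->]]]].
    by exists v, (h * g); rewrite conjgM; split=> //; apply: axisM.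
  exists (gen v ^ (h * g^-1)); last by rewrite -conjgM mulgVK.
  by exists v, (h * g^-1); split=> //; apply: axisMV.
move=> x y; apply/asboolP/asboolP => -[v [u [h [Yh vu]]]].
  move=> /(congr1 (fun z => z ^ g^-1)) + /(congr1 (fun z => z ^ g^-1)).
  rewrite !conjgK -!conjgM => -> ->.
  by exists v, u, (h * g^-1); split=> //; apply: axisMV.
move=> -> ->; exists v, u, (h * g); rewrite !conjgM; split=> //.
exact: axisM.
Qed.

Lemma axial_cocompact : cocompact_on g H.
Proof.
(* Bounded words over a finite alphabet give a finite set of representatives. *)
pose K := [set k | Y k /\ exists s : short, k = pi s * r].
exists (spanned e_sym e_irr K); split.
- by apply: spanned_sub => k [].
- apply: (@sub_finite_set _ _
    ((fun q : V * short => gen q.1 ^ (pi q.2 * r)) @` [set: V * short])).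
    by move=> _ [v [_ [[_ [s ->]] ->]]]; exists (v, s).
  exact/finite_image/finite_finset.
- move=> _ [v [h [/axis_decomp[s [a [ga Ys ->]]] ->]]].
  exists (gen v ^ (pi s * r)), a; split=> //; last by rewrite conjgM.
  by exists v, (pi s * r); split=> //; split=> //; exists s.
- move=> x y /asboolP[v [u [h [/axis_decomp[s [a [ga Ys ->]]] vu -> ->]]]].
  exists (gen v ^ (pi s * r)), (gen u ^ (pi s * r)), a.
  rewrite -!conjgM; split=> //; apply/asboolP.
  by exists v, u, (pi s * r); split=> //; split=> //; exists s.
Qed.

Lemma axial_spanned_axis : axial_subgraph R g H.
Proof.
split.
- by exists (gen l0.1 ^ r); exists l0.1, r; split=> //; apply: axis_root.
- apply: weakly_convex_spanned => h k; exact: axis_directed.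
- exact: axial_locally_finite.
- exact: axial_preserved.
- exact: axial_cocompact.
Qed.

End AxialSubgraph.

Theorem theorem4p11 (R : realType) (V : finType) (e : rel V)
    (e_sym : symmetric e) (e_irr : irreflexive e)
    (e_conn : forall u v : V, connect e u v) :
  finiteness_property e R.
Proof.
move=> g g_lox.
pose P n := `[< exists w r, size w = n /\ raag_pi e w * r = r * g >].
have exP : exists n, P n.
  exists (size (repr g)); apply/asboolP; exists (repr g), 1; split=> //.
  by rewrite raag_piK mulg1 mul1g.
case: (ex_minnP exP) => n /asboolP[w [r [wn w_conj]]] min_n.
have w_min w' r' : raag_pi e w' * r' = r' * g -> (size w <= size w')%N.
  by move=> h; rewrite wn; apply: min_n; apply/asboolP; exists w', r'.
case: w => [|l0 w] in wn w_conj w_min *; last first.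
  by eexists; apply: (@axial_spanned_axis _ _ e_sym e_irr e_conn R g r
    (l0 :: w) g_lox w_conj l0 _ w_min).
(* An empty shortest word forces [g = 1], whose orbits are single points. *)
have g1 : g = 1 by apply: (@mulgI _ r); rewrite -w_conj mul1g mulg1.
have [x Gx _] := g_lox; exfalso.
apply: (@bounded_orbit_not_loxodromic _ _ e_sym e_irr e_conn R g x 0 Gx _ g_lox).
by move=> k; exists 0%N => //; rewrite g1 expg1n conjg1; apply: walk0.
Qed.
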